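(* Let $1<p<\infty$, $N\in\mathbb{N}$, and let $f\in\ell^p_A$ with $f(0)=1$. Let $J_N$ be the unique element of $\{g\in f\mathscr{P}_N: g(0)=1\}$ of minimal $\ell^p_A$ norm. Then $$p_{N,f}=\frac{J_N/f}{1+\left(\|J_N\|_p^p-1\right)^{p'-1}},$$ where $p'$ is the Hölder conjugate exponent of $p$.
   Context: $\mathbb{N}=\{1,2,3,\dots\}$. For $1<p<\infty$, $\ell^p_A$ is the Banach space of power series $f(z)=\sum_{k\ge 0}a_kz^k$ (complex coefficients) with $\|f\|_p=\left(\sum_{k\ge0}|a_k|^p\right)^{1/p}<\infty$. $\mathscr{P}_N$ is the space of complex polynomials of degree at most $N$, and $f\mathscr{P}_N=\{fq:q\in\mathscr{P}_N\}$. For nonzero $f\in\ell^p_A$, the optimal polynomial approximant $p_{N,f}$ is the unique element of $\mathscr{P}_N$ with $\|1-p_{N,f}f\|_p=\inf_{q\in\mathscr{P}_N}\|1-qf\|_p$. By definition $J_N\in f\mathscr{P}_N$, so $J_N/f$ denotes the polynomial $q\in\mathscr{P}_N$ with $J_N=fq$. The Hölder conjugate $p'$ satisfies $1/p+1/p'=1$. *)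

(* Defs.v *)
From HB Require Import structures.
From mathcomp Require Import all_boot all_order all_algebra.
From mathcomp Require Import all_classical all_reals all_analysis.
From mathcomp Require Import complex.

Set Implicit Arguments.
Unset Strict Implicit.
Unset Printing Implicit Defensive.

Import Order.TTheory GRing.Theory Num.Theory.

Local Open Scope classical_set_scope.
Local Open Scope ring_scope.
Local Open Scope complex_scope.

(* A power series f(z) = sum_k a_k z^k is represented by its coefficient
   sequence a : nat -> R[i], so that f(0) is f 0%N. The library's ring
   structure on nat -> R[i] is the pointwise one, which is not the
   multiplication of power series; ps_mulp is the Cauchy product. *)

Section OptimalPolynomialApproximants.
Variable R : realType.
Implicit Types (p : R) (N : nat) (f g : nat -> R[i]) (q : {poly R[i]}).

Definition ps_of_poly q : nat -> R[i] := fun k => q`_k.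

Definition ps_sub f g : nat -> R[i] := fun k => f k - g k.

Definition ps_mulp f q : nat -> R[i] :=
  fun k => \sum_(i < k.+1) f (k - i)%N * q`_i.

(* By Lnorm_counting, for p > 0 this is (sum_k |f k|^p)^(1/p),
   with value +oo when the series diverges. *)
Definition ellp_norm p f : \bar R :=
  Lnorm counting p%:E (fun k => (Normc.normc (f k))%:E).

Definition ellpA p : set (nat -> R[i]) :=
  [set f | (ellp_norm p f < +oo)%E].

Definition polyN N : set {poly R[i]} := [set q | (size q <= N.+1)%N].

Definition opa_error p f q : \bar R :=
  ellp_norm p (ps_sub (ps_of_poly 1) (ps_mulp f q)).

Definition is_opa p N f q : Prop :=
  polyN N q /\
  opa_error p f q = ereal_inf [set opa_error p f r | r in polyN N].

Definition opa p N f : {poly R[i]} := xget 0 (is_opa p N f).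

Definition fpolyN N f : set (nat -> R[i]) := [set ps_mulp f q | q in polyN N].

Definition is_min_norm p (A : set (nat -> R[i])) g : Prop :=
  A g /\ forall h, A h -> (ellp_norm p g <= ellp_norm p h)%E.

Definition JN p N f : nat -> R[i] :=
  xget (fun=> 0) (is_min_norm p [set g | fpolyN N f g /\ g 0%N = 1]).

(* The polynomial g / f, for g in f P_N. *)
Definition ps_quot N g f : {poly R[i]} :=
  xget 0 [set q | polyN N q /\ g = ps_mulp f q].

End OptimalPolynomialApproximants.

(* Main.v *)
(* If [q] has constant term [c], then [1 - q f] has constant term [1 - c], so
   [||1 - q f||^p = |1 - c|^p + ||q f||^p - |c|^p]. For [c != 0] rescaling [q]
   by [1/c] gives [||q f||^p >= |c|^p ||J||^p], with equality only for
   [q = c (J/f)]. Hence the optimal [q] is [c (J/f)] for the unique [c]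
   minimising [|1 - c|^p + |c|^p t], where [t = ||J||^p - 1]; equating
   derivatives, [(1 - c)^(p-1) = t c^(p-1)], that is
   [c = 1 / (1 + t^(p'-1))].

   The minimiser [J] is unique by strict convexity of [||.||^p]. It exists
   because a seminorm attains its minimum on every line, hence, by passing to
   quotient seminorms, on every finite-dimensional affine subspace. *)

From HB Require Import structures.
Require Import Defs.
From mathcomp Require Import all_boot all_order all_algebra.
From mathcomp Require Import all_classical all_reals all_analysis.
From mathcomp Require Import complex ring lra.

Import Order.TTheory GRing.Theory Num.Theory.
Import numFieldNormedType.Exports.
Import ComplexField.Normc.

Local Open Scope ring_scope.
Local Open Scope complex_scope.
Local Open Scope classical_set_scope.

(** * Tangent lines and strict convexity of real powers *)

Lemma ln_lt_subr1 {R : realType} (x : R) : 0 < x -> x != 1 -> ln x < x - 1.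
Proof.
move=> x0 x1; rewrite ltrBrDl.
have lnx0 : ln x != 0 by rewrite ln_eq0.
by rewrite -[ltRHS]lnK ?posrE// expR_gt1Dx.
Qed.

(** The left side is [v^(p-1) m] with [m = v + p (u - v)], so in the main case, all quantities
    positive, logarithms reduce the claim to [(p-1) ln (v/u) + ln (m/u) < 0]. Apply [ln x <= x - 1],
    strict at [x = v/u]: the two linear bounds sum to zero. *)
Lemma powR_gt_tangent {R : realType} (p u v : R) :
  1 < p -> 0 <= u -> 0 <= v -> u != v ->
  v `^ p + p * v `^ (p - 1) * (u - v) < u `^ p.
Proof.
move=> p1 u0; rewrite le_eqVlt => /predU1P[<- uv|v0 uv].
  rewrite !powR0 ?mulr0 ?mul0r ?add0r; try (by apply/eqP; lra).
  by rewrite powR_gt0 // lt_neqAle eq_sym uv.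
have vp : v `^ p = v * v `^ (p - 1) by rewrite mulr_powRB1 //; lra.
have vp0 : 0 < v `^ (p - 1) by exact: powR_gt0.
have -> : v `^ p + p * v `^ (p - 1) * (u - v) =
    v `^ (p - 1) * (v + p * (u - v)).
  by rewrite vp; ring.
have [m0|m0] := leP (v + p * (u - v)) 0.
  move: u0; rewrite le_eqVlt => /predU1P[u0|u0].
    rewrite -u0 powR0; last by apply/eqP; lra.
    by rewrite pmulr_rlt0 //; nra.
  by rewrite (le_lt_trans _ (powR_gt0 p u0)) // pmulr_rle0.
have {}u0 : 0 < u by nra.
have /(congr1 (@ln R)) lnvp := vp.
rewrite -ltr_ln ?posrE ?mulr_gt0 ?powR_gt0 // lnM ?posrE // !ln_powR.
have A : ln v - ln u < v / u - 1.
  rewrite -ln_div ?posrE // ln_lt_subr1 ?divr_gt0 //.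
  by apply: contra uv => /eqP /divr1_eq ->.
have B : ln (v + p * (u - v)) - ln u <= (v + p * (u - v)) / u - 1.
  rewrite -ln_div ?posrE //.
  rewrite -[X in ln X](subrKC 1) le_ln1Dx // ltrBrDl subrr.
  by rewrite divr_gt0.
have C : (v + p * (u - v)) / u - 1 = - (p - 1) * (v / u - 1).
  by field; lra.
nra.
Qed.

Lemma powR_ge_tangent {R : realType} (p u v : R) :
  1 < p -> 0 <= u -> 0 <= v ->
  v `^ p + p * v `^ (p - 1) * (u - v) <= u `^ p.
Proof.
move=> p1 u0 v0; have [->|uv] := eqVneq u v; last exact/ltW/powR_gt_tangent.
by rewrite subrr mulr0 addr0.
Qed.

(** The tangent inequalities at the midpoint, one for [x] and one for [y], have linear terms that
    cancel on addition. *)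
Lemma powR_midpoint_lt {R : realType} (p x y : R) :
  1 < p -> 0 <= x -> 0 <= y -> x != y ->
  ((x + y) / 2) `^ p < (x `^ p + y `^ p) / 2.
Proof.
move=> p1 x0 y0 xy.
have v0 : 0 <= (x + y) / 2 by lra.
have xv : x != (x + y) / 2 by apply: contra xy => /eqP h; apply/eqP; lra.
have := powR_gt_tangent p x _ p1 x0 v0 xv.
have := powR_ge_tangent p y _ p1 y0 v0.
set a := _ `^ (p - 1); set b := _ `^ p.
nra.
Qed.

(** * Convexity of powers of complex moduli *)

Section Normc.
Context {R : realType}.
Implicit Types a b c : R[i].

Lemma normc_ge0 c : 0 <= normc c.
Proof. by case: c => x y /=; exact: sqrtr_ge0. Qed.

Lemma normc_gt0 c : c != 0 -> 0 < normc c.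
Proof.
move=> c0; rewrite lt_neqAle normc_ge0 andbT eq_sym.
by apply: contra c0 => /eqP /eq0_normc ->.
Qed.

Lemma sqr_normcE c : normc c ^+ 2 = complex.Re c ^+ 2 + complex.Im c ^+ 2.
Proof. by case: c => x y /=; rewrite sqr_sqrtr // addr_ge0 ?sqr_ge0. Qed.

Lemma normc_real (x : R) : normc x%:C = `|x|.
Proof. by rewrite /= expr0n addr0 sqrtr_sqr. Qed.

(** Parallelogram law: [|(a + b)/2|^2 = |a|^2 - |a - b|^2/4] when [|a| = |b|]. *)
Lemma normc_midpoint_lt a b :
  a != b -> normc a = normc b -> normc ((2^-1)%:C * (a + b)) < normc a.
Proof.
move=> ab nab; rewrite -(ltr_pXn2r (n := 2)) ?nnegrE ?normc_ge0 //.
move/(congr1 (fun x => x ^+ 2)): nab; rewrite !sqr_normcE.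
move: a b ab => [a1 a2] [b1 b2] /=; rewrite eq_complex /= => ab h.
have : 0 < (a1 - b1) ^+ 2 + (a2 - b2) ^+ 2.
  rewrite lt_neqAle addr_ge0 ?sqr_ge0 // andbT eq_sym paddr_eq0 ?sqr_ge0 //.
  by rewrite !sqrf_eq0 !subr_eq0.
rewrite !mul0r subr0 addr0; nra.
Qed.

(** Strictness comes from the roundness of the circle when the moduli agree, and from strict
    convexity of the real power when they differ. *)
Lemma powR_normc_midpoint_lt (p : R) a b : 1 < p -> a != b ->
  normc ((2^-1)%:C * (a + b)) `^ p < (normc a `^ p + normc b `^ p) / 2.
Proof.
move=> p1 ab; have p0 : 0 < p by lra.
have [nab|nab] := eqVneq (normc a) (normc b).
  rewrite -nab -[ltRHS]/((_ + _) / 2) -mulr2n.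
  rewrite -[X in X / 2]mulr_natr mulfK ?pnatr_eq0 //.
  by rewrite gt0_ltr_powR ?nnegrE ?normc_ge0 // normc_midpoint_lt.
apply: le_lt_trans (powR_midpoint_lt p _ _ p1 (normc_ge0 a) (normc_ge0 b) nab).
rewrite ge0_ler_powR ?nnegrE ?normc_ge0 ?(ltW p0) ?divr_ge0 //;
  rewrite ?addr_ge0 ?normc_ge0 //.
rewrite normcM normc_real ger0_norm ?invr_ge0 // mulrC.
by rewrite ler_pM2r ?invr_gt0 // le_normcD.
Qed.

Lemma powR_normc_midpoint_le (p : R) a b : 1 < p ->
  normc ((2^-1)%:C * (a + b)) `^ p <= (normc a `^ p + normc b `^ p) / 2.
Proof.
move=> p1; have [->|ab] := eqVneq a b; last exact/ltW/powR_normc_midpoint_lt.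
have -> : (2^-1)%:C * (b + b) = b.
  by case: b => x y; apply/eqP; rewrite eq_complex /=; apply/andP; split;
    apply/eqP; field.
lra.
Qed.

End Normc.

(* At the minimiser [c] the derivative condition [(1 - c)^(p-1) = t c^(p-1)]
   makes the two tangent-line slopes agree. *)
Lemma powR_normc_affine_min {R : realType} (p p' t : R) (z : R[i]) :
  1 < p -> p^-1 + p'^-1 = 1 -> 0 <= t ->
  let c := (1 + t `^ (p' - 1))^-1 in
  (1 - c) `^ p + c `^ p * t <= normc (1 - z) `^ p + normc z `^ p * t
  ?= iff (z == c%:C).
Proof.
move=> p1 hp' t0 c.
have pp' : (p' - 1) * (p - 1) = 1.
  (* Since [0^-1 = 0], the case [p' = 0] would give [p = 1]. *)
  have p'0 : p' != 0.
    apply/eqP => p'0; move: hp'; rewrite p'0 invr0 addr0.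
    by move/(congr1 GRing.inv); rewrite invrK invr1; lra.
  have : (p^-1 + p'^-1) * (p * p') = p * p' by rewrite hp' mul1r.
  rewrite mulrDl mulrA mulVf ?mul1r; last by apply/eqP; lra.
  rewrite [p * p']mulrC mulrA mulVf // mul1r; lra.
have p'1 : 0 < p' - 1 by rewrite -(pmulr_lgt0 _ (_ : 0 < p - 1)) ?pp'; lra.
set s := t `^ (p' - 1) in c *.
have s0 : 0 <= s by exact: powR_ge0.
have c0 : 0 < c by rewrite invr_gt0; lra.
have cE : 1 - c = s * c by rewrite /c; field; lra.
have c1 : 0 <= 1 - c by rewrite cE mulr_ge0 // ltW.
have slope : (1 - c) `^ (p - 1) = c `^ (p - 1) * t.
  by rewrite cE powRM ?(ltW c0) // -powRrM pp' powRr1 // mulrC.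
set x := normc (1 - z); set y := normc z.
have x0 : 0 <= x := normc_ge0 _.
have y0 : 0 <= y := normc_ge0 _.
have xy : 1 <= x + y.
  have := le_normcD (1 - z) z.
  by rewrite subrK normc1.
set l := (1 - c) `^ (p - 1).
rewrite -/l in slope.
have l0 : 0 <= l by exact: powR_ge0.
have := powR_ge_tangent p y c p1 y0 (ltW c0).
have := powR_ge_tangent p x _ p1 x0 c1.
rewrite -/l => tx ty.
(* Multiplied by [t], the tangent at [c] has slope [p * l], like the one at [1 - c]. The linear
   terms then add up to [p * l * (x + y - 1)], nonnegative by the triangle inequality. *)
have tyt : c `^ p * t + p * l * (y - c) <= y `^ p * t.
  by rewrite slope; nra.
have lxy : 0 <= p * l * (x + y - 1) by rewrite !mulr_ge0 ?subr_ge0 //; lra.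
split; first by nra.
apply/eqP/eqP => [eqF|zc].
  have xc : x = 1 - c.
    apply/eqP/contraT => xc.
    have := powR_gt_tangent p x _ p1 x0 c1 xc; rewrite -/l; nra.
  have yc : y = c.
    apply/eqP/contraT => yc.
    (* For [t = 0] the term in [y] drops out of the equality, but then [c = 1], and [x = 0] forces
       [z = 1]. *)
    have [t00|tgt0] := eqVneq t 0.
      have s00 : s = 0 by rewrite /s t00 powR0 //; apply/eqP; lra.
      have c11 : c = 1 by rewrite /c s00 addr0 invr1.
      have /subr0_eq z1 : 1 - z = 0.
        by apply: eq0_normc; rewrite -/x xc c11 subrr.
      by move: yc; rewrite /y -z1 normc1 c11 eqxx.
    have {}tgt0 : 0 < t by rewrite lt_neqAle eq_sym tgt0.
    have := powR_gt_tangent p y c p1 y0 (ltW c0) yc.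
    rewrite -(ltr_pM2r tgt0) mulrDl -!mulrA [(y - c) * t]mulrC.
    rewrite [c `^ (p - 1) * _]mulrA -slope -/l; nra.
  (* Subtracting [|z|^2 = c^2] from [|1 - z|^2 = (1 - c)^2] gives [Re z = c], and then
     [Im z = 0]. *)
  move/(congr1 (fun x => x ^+ 2)): xc; move/(congr1 (fun x => x ^+ 2)): yc.
  rewrite !sqr_normcE; case: z {x y x0 y0 xy tx ty tyt lxy eqF} => a b /= h1 h2.
  have ac : a = c by nra.
  have b0 : b = 0 by apply/eqP; rewrite -sqrf_eq0; apply/eqP; nra.
  by rewrite ac b0.
rewrite /x /y zc -(rmorph1 (real_complex R)) -rmorphB !normc_real.
by rewrite !ger0_norm // ltW.
Qed.

(** * Minimising seminorms over finite-dimensional affine subspaces *)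

Section RealSeminorm.
Context {R : realType} {V : lmodType R[i]}.
Implicit Types (G : V -> R) (A : set V) (x y e : V) (t : R).

(** Scalars are real because minimisation runs along real lines. For [t != 0] the reverse inequality
    follows by scaling back with [t^-1]. *)
Definition real_seminorm G :=
  (forall x y, G (x + y) <= G x + G y) /\
  (forall t x, G (t%:C *: x) <= `|t| * G x).

Lemma real_seminorm_ge0 G x : real_seminorm G -> 0 <= G x.
Proof.
move=> [GD GZ].
have G0 : G 0 <= 0 by have := GZ 0 0; rewrite scaler0 normr0 mul0r.
have := GD 0 0; have := GD x (- x); have := GZ (-1) x.
by rewrite rmorphN1 scaleN1r normrN1 mul1r subrr addr0; lra.
Qed.

(** Along the line [G] is Lipschitz with constant [G e]. If [G e = 0] it is constant there;
    otherwise it grows linearly, and the extreme value theorem on a large interval suffices. *)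
Lemma real_seminorm_line_min G x e : real_seminorm G ->
  exists t, forall s, G (x + t%:C *: e) <= G (x + s%:C *: e).
Proof.
move=> sG; have [GD GZ] := sG.
have Ge0 := real_seminorm_ge0 _ e sG; have Gx0 := real_seminorm_ge0 _ x sG.
have lip t s : G (x + t%:C *: e) - G (x + s%:C *: e) <= `|t - s| * G e.
  have := GD (x + s%:C *: e) ((t - s)%:C *: e); have := GZ (t - s) e.
  by rewrite -addrA -scalerDl -rmorphD /= subrKC; lra.
move: Ge0; rewrite le_eqVlt => /predU1P[Ge|Ge].
  exists 0 => s; have := lip 0 s; rewrite -Ge mulr0; lra.
(* For [|s| > M] one has [G (x + s e) >= |s| G e - G x > G x], so parameters outside [[-M, M]] do
   worse than [0]. *)
pose M := 2 * G x / G e.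
have M0 : 0 <= M by rewrite divr_ge0 ?mulr_ge0 // ltW.
have cont : continuous (fun t => G (x + t%:C *: e)).
  move=> t; apply/cvgrPdist_lt => eps eps0; near=> s.
  have ts : `|t - s| * G e < eps.
    rewrite -ltr_pdivlMr //; near: s.
    exact: (@nbhsx_ballx _ R^o t _ (divr_gt0 eps0 Ge)).
  rewrite ltr_norml; have := lip t s; have := lip s t.
  by rewrite (distrC s t); lra.
have [||t tM tmin] := @EVT_min R (fun t => G (x + t%:C *: e)) (- M) M.
- by lra.
- exact: continuous_subspaceT.
exists t => s; have [sM|sM] := boolP (s \in `[- M, M]%R); first exact: tmin.
have h0 : G (x + t%:C *: e) <= G x.
  have := tmin 0; rewrite scale0r addr0; apply.
  by rewrite in_itv /= oppr_le0 M0.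
apply: (le_trans h0).
have Ms : M < `|s|.
  by rewrite ltNge; apply: contra sM; rewrite ler_norml in_itv.
have : 2 * G x < `|s| * G e by rewrite -ltr_pdivrMr.
have [s0|s0] := eqVneq s 0; first by rewrite s0 normr0 in Ms; lra.
have e1 : `|s| * G e <= G (s%:C *: e).
  have := GZ s^-1 (s%:C *: e).
  rewrite scalerA -rmorphM /= mulVf // scale1r normfV.
  by rewrite mulrC ler_pdivlMr ?normr_gt0 // mulrC.
have e2 : G (s%:C *: e) <= G (x + s%:C *: e) + G x.
  have := GD (x + s%:C *: e) (- x); have := GZ (-1) x.
  by rewrite rmorphN1 scaleN1r normrN1 mul1r [x + _]addrC addrK; lra.
by lra.
Unshelve. all: end_near.
Qed.

(** Quantified over all [G] and [x], so that an induction on dimension may pass to quotient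
    seminorms. *)
Definition seminorm_proximinal A := forall G x, real_seminorm G ->
  exists2 y, A y & forall z, A z -> G (x + y) <= G (x + z).

Lemma seminorm_proximinal1 y : seminorm_proximinal [set y].
Proof. by move=> G x _; exists y => // _ ->. Qed.

(* Minimising over the line first turns [G] into the quotient seminorm of [G]
   by the line, to which the hypothesis on [A] applies. *)
Lemma seminorm_proximinal_line A e : seminorm_proximinal A ->
  seminorm_proximinal [set y + t%:C *: e | y in A & t in setT].
Proof.
move=> pA G x sG; have [GD GZ] := sG.
have [tm tmP] := choice (fun y => real_seminorm_line_min G y e sG).
have sG' : real_seminorm (fun y => G (y + (tm y)%:C *: e)).
  split=> [y z|t y].
    (* As [tm] is minimal, any parameter gives an upper bound: [tm y + tm z] for the sum, [t * tm y]
       below for the multiple. *)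
    apply: le_trans (tmP _ (tm y + tm z)) (le_trans _ (GD _ _)).
    by rewrite rmorphD /= scalerDl addrACA.
  apply: le_trans (tmP _ (t * tm y)) (le_trans _ (GZ _ _)).
  by rewrite rmorphM /= scalerDr scalerA.
have [y Ay ymin] := pA _ x sG'.
exists (y + (tm (x + y))%:C *: e) => [|_ [z Az] [s _] <-].
  by exists y => //; exists (tm (x + y)).
rewrite !addrA; exact: le_trans (ymin _ Az) (tmP _ _).
Qed.

End RealSeminorm.

(** Raising [N] by one adds a complex dimension, that is, two real lines, spanned by ['X^(N.+1)] and
    ['i *: 'X^(N.+1)]. *)
Lemma seminorm_proximinal_poly {R : realType} (N : nat) :
  seminorm_proximinal [set q : {poly R[i]} | (size q <= N.+1)%N /\ q`_0 = 0].
Proof.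
elim: N => [|N IH].
  rewrite (_ : [set _ | _] = [set 0]); first exact: seminorm_proximinal1.
  apply/seteqP; split=> [q [/size1_polyC qE q0]|_ ->]; rewrite /=.
    by rewrite qE q0.
  by rewrite size_poly0 coef0.
rewrite (_ : [set _ | _] = [set y + s%:C *: ('i *: 'X^(N.+1)) |
    y in [set z + t%:C *: 'X^(N.+1) | z in
      [set q : {poly R[i]} | (size q <= N.+1)%N /\ q`_0 = 0] & t in setT] &
    s in setT]).
  by do 2 apply: seminorm_proximinal_line.
apply/seteqP; split=> [q [sq q0]|_ [_ [q [sq q0] [t _ <-]] [s _] <-]] /=.
  exists (q - q`_N.+1 *: 'X^(N.+1) + (complex.Re q`_N.+1)%:C *: 'X^(N.+1)).
    exists (q - q`_N.+1 *: 'X^(N.+1)); last by exists (complex.Re q`_N.+1).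
    split; last by rewrite coefB coefZ coefXn mulr0 q0 subrr.
    apply/leq_sizeP => j; rewrite leq_eqVlt => /predU1P[<-|jN].
      by rewrite coefB coefZ coefXn eqxx mulr1 subrr.
    rewrite coefB coefZ coefXn (gtn_eqF jN) mulr0 subr0.
    by move/leq_sizeP: sq; apply.
  exists (complex.Im q`_N.+1) => //.
  rewrite -addrA scalerA -scalerDl mulrC -complexE -scaleNr -addrA -scalerDl.
  by rewrite addNr scale0r addr0.
split; last by rewrite !coefD !coefZ !coefXn !mulr0 !addr0 q0.
apply/leq_sizeP => j jN.
rewrite !coefD !coefZ !coefXn (gtn_eqF jN) !mulr0 !addr0.
by move/leq_sizeP: sq; apply; exact: ltnW.
Qed.

(** * Power sums and the [ell^p] norm *)

(** Splitting off the [n]-th term isolates the strict inequality; the rest of the [u] series is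
    finite, so adding it keeps strictness. *)
Lemma lt_nneseries {R : realType} (u v : nat -> R) (n : nat) :
  (forall k, 0 <= u k) -> (forall k, u k <= v k) -> u n < v n ->
  (\sum_(0 <= k <oo) (v k)%:E < +oo)%E ->
  (\sum_(0 <= k <oo) (u k)%:E < \sum_(0 <= k <oo) (v k)%:E)%E.
Proof.
move=> u0 uv uvn vfin.
have v0 k : 0 <= v k by exact: le_trans (uv k).
have le_tail : (\sum_(0 <= k <oo | true && (k != n)) (u k)%:E <=
    \sum_(0 <= k <oo | true && (k != n)) (v k)%:E)%E.
  by apply: lee_nneseries => k *; rewrite lee_fin.
have tail0 : (0 <= \sum_(0 <= k <oo | true && (k != n)) (u k)%:E)%E.
  by apply: nneseries_ge0 => k *; rewrite lee_fin.
move: vfin; rewrite (nneseriesD1 (n := n)) // => [|k _]; last first.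
  by rewrite lee_fin.
rewrite (nneseriesD1 (f := EFin \o u) (n := n)) //= => [vfin|k _]; last first.
  by rewrite lee_fin.
rewrite lte_leD ?lte_fin // ge0_fin_numE //.
by apply: le_lt_trans vfin; rewrite (le_trans le_tail) // leeDr // lee_fin.
Qed.

(* Locked, with [energy] below: otherwise [//] and [lra] may unfold the limit
   of partial sums and diverge. *)
HB.lock Definition ellp_sum {R : realType} (p : R) (g : nat -> R[i])
  : \bar R := (\sum_(0 <= k <oo) (normc (g k) `^ p)%:E)%E.

Section EllpSum.
Context {R : realType}.
Implicit Types (p : R) (g h : nat -> R[i]).

Lemma ellp_sum_ge0 p g : (0 <= ellp_sum p g)%E.
Proof.
rewrite ellp_sum.unlock; apply: nneseries_ge0 => k *.
by rewrite lee_fin powR_ge0.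
Qed.

Lemma ellp_normE p g : 0 < p -> ellp_norm p g = (ellp_sum p g `^ p^-1)%E.
Proof.
move=> p0; rewrite /ellp_norm Lnorm_counting // ellp_sum.unlock.
congr (_ `^ _)%E; apply: eq_eseriesr => k _.
by rewrite abse_EFin ger0_norm ?normc_ge0 // poweR_EFin.
Qed.

Lemma ellpA_sumP p g : 0 < p -> ellpA p g <-> (ellp_sum p g < +oo)%E.
Proof.
move=> p0; rewrite /ellpA /= ellp_normE //; split; last exact: poweR_lty.
by apply: lty_poweRy; rewrite invr_neq0 // gt_eqF.
Qed.

Lemma ellp_sum_recl p g : ellp_sum p g =
  ((normc (g 0%N) `^ p)%:E + \sum_(1 <= k <oo) (normc (g k) `^ p)%:E)%E.
Proof.
by rewrite ellp_sum.unlock nneseries_recl // => k _; rewrite lee_fin powR_ge0.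
Qed.

Lemma ellp_sumZ p c g :
  ellp_sum p (fun k => c * g k) = ((normc c `^ p)%:E * ellp_sum p g)%E.
Proof.
rewrite ellp_sum.unlock -nneseriesZl => [|k _]; last first.
  by rewrite lee_fin powR_ge0.
by apply: eq_eseriesr => k _; rewrite normcM powRM ?normc_ge0 // EFinM.
Qed.

Lemma ellp_sum_shift p g : p != 0 ->
  ellp_sum p (fun k => if k is k'.+1 then g k' else 0) = ellp_sum p g.
Proof.
move=> p0; rewrite ellp_sum_recl normc0 powR0 // add0e ellp_sum.unlock.
rewrite -nneseries_addn => [|k]; last by rewrite lee_fin powR_ge0.
by apply: eq_eseriesr => k _; rewrite addn1.
Qed.

(** The triangle inequality termwise, then Minkowski for the sequences of moduli. *)
Lemma ellp_norm_leD p g h : 1 <= p ->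
  (ellp_norm p (g \+ h)%R <= ellp_norm p g + ellp_norm p h)%E.
Proof.
move=> p1; have p0 : 0 < p by exact: lt_le_trans p1.
pose ng k := normc (g k); pose nh k := normc (h k).
apply: (@le_trans _ _ (Lnorm counting p%:E (EFin \o (ng \+ nh)%R))); last first.
  by apply: minkowski_EFin.
rewrite /ellp_norm !Lnorm_counting // gt0_ler_poweR ?invr_ge0 ?(ltW p0) //.
- by rewrite in_itv /= leey andbT nneseries_ge0 // => k *; exact: poweR_ge0.
- by rewrite in_itv /= leey andbT nneseries_ge0 // => k *; exact: poweR_ge0.
apply: lee_nneseries => [k *|k _]; first exact: poweR_ge0.
rewrite /= !ger0_norm ?addr_ge0 ?normc_ge0 // lee_fin.
by rewrite ge0_ler_powR ?nnegrE ?addr_ge0 ?normc_ge0 ?(ltW p0) // le_normcD.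
Qed.

Lemma ellpAD p g h : 1 <= p -> ellpA p g -> ellpA p h -> ellpA p (g \+ h).
Proof.
move=> p1 pg ph; apply: le_lt_trans (ellp_norm_leD _ _ _ p1) _.
exact: lte_add_pinfty.
Qed.

Lemma ellpAZ p c g : 0 < p -> ellpA p g -> ellpA p (fun k => c * g k).
Proof.
move=> p0 /ellpA_sumP - /(_ p0) pg; apply/ellpA_sumP => //.
by rewrite ellp_sumZ lte_mul_pinfty // lee_fin powR_ge0.
Qed.

(** The midpoint inequality holds termwise and is strict at an index where [g] and [h] differ. *)
Lemma ellp_sum_midpoint_lt p g h : 1 < p -> ellpA p g -> ellpA p h -> g <> h ->
  (ellp_sum p (fun k => (2^-1)%:C * (g k + h k))%R <
    (2^-1)%:E * (ellp_sum p g + ellp_sum p h))%E.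
Proof.
move=> p1 pg ph gh; have p0 : 0 < p by exact: lt_trans p1.
have [n ghn] : exists n, g n != h n.
  apply: contra_notP gh => /forallNP gh; apply/funext => n.
  by apply/eqP; rewrite -[_ == _]negbK; apply/negP; exact: gh.
have rhsE : ((2^-1)%:E * (ellp_sum p g + ellp_sum p h) =
    \sum_(0 <= k <oo) ((normc (g k) `^ p + normc (h k) `^ p) / 2)%R%:E)%E.
  rewrite ellp_sum.unlock -nneseriesD -?nneseriesZl; first last.
  - by move=> k *; rewrite lee_fin powR_ge0.
  - by move=> k *; rewrite lee_fin powR_ge0.
  - by move=> k *; rewrite -EFinD lee_fin addr_ge0 ?powR_ge0.
  by apply: eq_eseriesr => k _; rewrite -EFinD -EFinM mulrC.
rewrite rhsE ellp_sum.unlock; apply: (@lt_nneseries _ _ _ n) => [k|k||].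
- exact: powR_ge0.
- exact: powR_normc_midpoint_le.
- exact: powR_normc_midpoint_lt.
- rewrite -rhsE lte_mul_pinfty ?lee_fin ?invr_ge0 //.
  by apply: lte_add_pinfty; exact/ellpA_sumP.
Qed.

End EllpSum.

(** * The Cauchy product of a power series and a polynomial *)

Section PowerSeriesProduct.
Context {R : realType}.
Implicit Types (f : nat -> R[i]) (q r : {poly R[i]}).

Lemma ps_mulpD f q r : ps_mulp f (q + r) = ps_mulp f q \+ ps_mulp f r.
Proof.
apply/funext => k; rewrite /ps_mulp /= -big_split /=.
by apply: eq_bigr => i _; rewrite coefD mulrDr.
Qed.

Lemma ps_mulpZ f c q : ps_mulp f (c *: q) = (fun k => c * ps_mulp f q k).
Proof.
apply/funext => k; rewrite /ps_mulp mulr_sumr.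
by apply: eq_bigr => i _; rewrite coefZ mulrCA.
Qed.

Lemma ps_mulpC f c : ps_mulp f c%:P = (fun k => c * f k).
Proof.
apply/funext => k; rewrite /ps_mulp big_ord_recl subn0 coefC eqxx.
rewrite big1 ?addr0 1?mulrC //.
by move=> i _; rewrite coefC mulr0.
Qed.

Lemma ps_mulpMX f q :
  ps_mulp f (q * 'X) = (fun k => if k is k'.+1 then ps_mulp f q k' else 0).
Proof.
apply/funext => -[|k]; rewrite /ps_mulp big_ord_recl coefMX eqxx mulr0 add0r.
  by rewrite big_ord0.
by apply: eq_bigr => i _; rewrite coefMX.
Qed.

(** As [f 0 = 1], the [k]-th coefficient of the product is [q_k] plus terms in earlier coefficients
    of [q], which strong induction identifies. *)
Lemma ps_mulp_inj f : f 0%N = 1 -> injective (ps_mulp f).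
Proof.
move=> f0 q r /(congr1 (fun g : nat -> R[i] => g)) qr; apply/polyP.
elim/ltn_ind => k IH; have := congr1 (fun g => g k) qr.
rewrite /ps_mulp !big_ord_recr /= subnn f0 !mul1r.
rewrite (eq_bigr (fun i : 'I_k => f (k - i)%N * r`_i)) => [|i _].
  exact: addrI.
by rewrite IH.
Qed.

Lemma ps_mulp0 f q : f 0%N = 1 -> ps_mulp f q 0%N = q`_0.
Proof. by move=> f0; rewrite /ps_mulp big_ord1 f0 mul1r. Qed.

(** Horner induction: shifts, scalar multiples and sums stay in [ell^p]. *)
Lemma ellpA_ps_mulp (p : R) f q : 1 <= p -> ellpA p f -> ellpA p (ps_mulp f q).
Proof.
move=> p1 pf; have p0 : 0 < p by exact: lt_le_trans p1.
elim/poly_ind: q => [|q c IH].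
  by rewrite ps_mulpC; exact: ellpAZ.
rewrite ps_mulpD ps_mulpC ps_mulpMX; apply: ellpAD => //; last exact: ellpAZ.
by apply/ellpA_sumP => //; rewrite ellp_sum_shift ?gt_eqF //; apply/ellpA_sumP.
Qed.

Lemma real_seminorm_ps_mulp (p : R) f : 1 <= p -> ellpA p f ->
  real_seminorm (fun q => fine (ellp_norm p (ps_mulp f q))).
Proof.
move=> p1 pf; have p0 : 0 < p by exact: lt_le_trans p1.
have fin q : ellp_norm p (ps_mulp f q) \is a fin_num.
  by rewrite ge0_fin_numE ?Lnorm_ge0 //; exact: ellpA_ps_mulp.
split=> [q r|t q].
  rewrite -fineD // fine_le ?fin_numD ?fin // ps_mulpD; exact: ellp_norm_leD.
rewrite ps_mulpZ !ellp_normE // ellp_sumZ normc_real.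
rewrite poweRM ?lee_fin ?powR_ge0 ?ellp_sum_ge0 //.
rewrite poweR_EFin -powRrM divff ?gt_eqF // powRr1 // fineM //.
by rewrite -ellp_normE.
Qed.

End PowerSeriesProduct.

(** * The energy [||f q||_p^p] and its minimiser *)

Lemma ler_powR2r {R : realType} (r x y : R) : 0 < r -> 0 <= x -> 0 <= y ->
  (x `^ r <= y `^ r) = (x <= y).
Proof.
move=> r0 x0 y0; apply/idP/idP => [|xy].
  by apply: contraTT; rewrite -!ltNge => yx; rewrite gt0_ltr_powR ?nnegrE.
by rewrite ge0_ler_powR ?nnegrE // ltW.
Qed.

HB.lock Definition energy {R : realType} (p : R) (f : nat -> R[i])
  (q : {poly R[i]}) : R := fine (ellp_sum p (ps_mulp f q)).

Section Energy.
Context {R : realType}.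
Implicit Types (p : R) (f : nat -> R[i]) (q r J : {poly R[i]}) (N : nat).

Lemma ellp_sum_ps_mulp p f q : 1 <= p -> ellpA p f ->
  ellp_sum p (ps_mulp f q) = (energy p f q)%:E.
Proof.
move=> p1 pf; have p0 : 0 < p by exact: lt_le_trans p1.
rewrite energy.unlock fineK // ge0_fin_numE ?ellp_sum_ge0 //.
by apply/ellpA_sumP => //; exact: ellpA_ps_mulp.
Qed.

Lemma energy_ge0 p f q : 0 <= energy p f q.
Proof. by rewrite energy.unlock fine_ge0 // ellp_sum_ge0. Qed.

Lemma ellp_norm_ps_mulp p f q : 1 <= p -> ellpA p f ->
  ellp_norm p (ps_mulp f q) = (energy p f q `^ p^-1)%:E.
Proof.
move=> p1 pf; rewrite ellp_normE; last exact: lt_le_trans p1.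
by rewrite ellp_sum_ps_mulp // poweR_EFin.
Qed.

Lemma energyZ p f c q : energy p f (c *: q) = normc c `^ p * energy p f q.
Proof.
rewrite energy.unlock ps_mulpZ ellp_sumZ.
(* The sum may be [+oo], which [fine] sends to [0]. With a positive factor both sides are then [0];
   a zero factor is treated apart. *)
have [->|c0] := eqVneq (normc c `^ p) 0; first by rewrite mul0e mul0r.
have : (0 <= ellp_sum p (ps_mulp f q))%E := ellp_sum_ge0 _ _.
have cp : 0 < normc c `^ p by rewrite lt_neqAle eq_sym c0 powR_ge0.
by case: ellp_sum => //= _; rewrite mulry gtr0_sg // mul1e mulr0.
Qed.

Lemma energy0 p f : p != 0 -> energy p f 0 = 0.
Proof. by move=> p0; rewrite -(scale0r 0) energyZ normc0 powR0 // mul0r. Qed.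

Lemma energy_midpoint_lt p f q r : 1 < p -> ellpA p f -> f 0%N = 1 -> q != r ->
  energy p f ((2^-1)%:C *: (q + r)) < (energy p f q + energy p f r) / 2.
Proof.
move=> p1 pf f0 qr; have p1' := ltW p1.
rewrite -lte_fin [_ / 2]mulrC EFinM EFinD -!ellp_sum_ps_mulp //.
rewrite ps_mulpZ ps_mulpD; apply: ellp_sum_midpoint_lt => //.
- exact: ellpA_ps_mulp.
- exact: ellpA_ps_mulp.
- by move/(ps_mulp_inj f f0)/eqP; exact/negP.
Qed.

(** Strict midpoint convexity between [q] and [0]: half the energy of [q] exceeds that of [q/2],
    which is nonnegative. *)
Lemma energy_gt0 p f q : 1 < p -> ellpA p f -> f 0%N = 1 -> q != 0 ->
  0 < energy p f q.
Proof.
move=> p1 pf f0 q0; have := energy_midpoint_lt p f _ _ p1 pf f0 q0.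
rewrite energy0; last by rewrite gt_eqF // (lt_trans ltr01).
have := energy_ge0 p f ((2^-1)%:C *: (q + 0)); lra.
Qed.

Lemma ellp_sum_tail p f q : 1 <= p -> ellpA p f -> f 0%N = 1 ->
  (\sum_(1 <= k <oo) (normc (ps_mulp f q k) `^ p)%:E =
  (energy p f q - normc q`_0 `^ p)%R%:E)%E.
Proof.
move=> p1 pf f0; rewrite EFinB -ellp_sum_ps_mulp // ellp_sum_recl ps_mulp0 //.
by rewrite addeAC subee // add0e.
Qed.

Lemma energy_ge_coef0 p f q : 1 <= p -> ellpA p f -> f 0%N = 1 ->
  normc q`_0 `^ p <= energy p f q.
Proof.
move=> p1 pf f0; rewrite -subr_ge0 -lee_fin -ellp_sum_tail //.
by apply: nneseries_ge0 => k *; rewrite lee_fin powR_ge0.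
Qed.

(** Beyond the constant coefficient, [1 - q f] and [q f] differ only by sign. *)
Lemma opa_errorE p f q : 1 <= p -> ellpA p f -> f 0%N = 1 ->
  opa_error p f q =
  ((normc (1 - q`_0) `^ p + (energy p f q - normc q`_0 `^ p)) `^ p^-1)%:E.
Proof.
move=> p1 pf f0; rewrite /opa_error ellp_normE; last exact: lt_le_trans p1.
rewrite ellp_sum_recl -[RHS]poweR_EFin; congr (_ `^ _)%E.
rewrite EFinD -ellp_sum_tail //; congr (_ + _)%E.
  by rewrite /ps_sub /ps_of_poly coef1 ps_mulp0.
rewrite -nneseries_addn => [|k]; last by rewrite lee_fin powR_ge0.
rewrite -[RHS]nneseries_addn => [|k]; last by rewrite lee_fin powR_ge0.
apply: eq_eseriesr => k _.
by rewrite addn1 /ps_sub /ps_of_poly coef1 sub0r normcN.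
Qed.

(** [J] stands for the polynomial factor [J_N / f]; the series [J_N] itself is [ps_mulp f J]. *)
Definition energy_min p N f J := (polyN N J /\ J`_0 = 1) /\
  forall q, polyN N q -> q`_0 = 1 -> energy p f J <= energy p f q.

(** The competitors are [1 + y] with [y] of zero constant term, so proximinality is applied at the
    base point [1]. *)
Lemma energy_min_exists p N f : 1 <= p -> ellpA p f ->
  exists J, energy_min p N f J.
Proof.
move=> p1 pf; have p0 : 0 < p by exact: lt_le_trans p1.
have [y [sy y0] ymin] :=
  seminorm_proximinal_poly N _ 1 (real_seminorm_ps_mulp p f p1 pf).
exists (1 + y); split.
  rewrite coefD coef1 y0 addr0; split=> //.
  by rewrite /polyN /= (leq_trans (size_polyD _ _)) // geq_max size_poly1.
move=> q sq q0; have := ymin (q - 1).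
rewrite [1 + (q - 1)]addrC subrK !ellp_norm_ps_mulp //=.
rewrite ler_powR2r ?invr_gt0 ?energy_ge0 //.
apply; split; last by rewrite coefB coef1 q0 subrr.
by rewrite (leq_trans (size_polyD _ _)) // geq_max sq size_polyN size_poly1.
Qed.

(** Otherwise the midpoint of [q] and [J], again with constant term 1, would have less energy than
    [J]. *)
Lemma energy_min_unique p N f J q : 1 < p -> ellpA p f -> f 0%N = 1 ->
  energy_min p N f J -> polyN N q -> q`_0 = 1 ->
  energy p f q <= energy p f J -> q = J.
Proof.
move=> p1 pf f0 [[sJ J0] Jmin] sq q0 qJ; apply/eqP/contraT => neq.
have := energy_midpoint_lt p f _ _ p1 pf f0 neq.
have : energy p f J <= energy p f ((2^-1)%:C *: (q + J)).
  apply: Jmin.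
    rewrite /polyN /= (leq_trans (size_scale_leq _ _)) //.
    by rewrite (leq_trans (size_polyD _ _)) // geq_max sq.
  rewrite coefZ coefD q0 J0.
  by apply/eqP; rewrite eq_complex /=; apply/andP; split; apply/eqP; field.
move=> Jm /(le_lt_trans Jm); rewrite ltr_pdivlMr // mulr_natr mulr2n.
by rewrite ltrD2r ltNge qJ.
Qed.

(** If [q_0 != 0], divide by it and use minimality and uniqueness of [J]. If [q_0 = 0], the left
    side vanishes, and zero energy means [q = 0]. *)
Lemma energy_min_homogeneous p N f J q : 1 < p -> ellpA p f -> f 0%N = 1 ->
  energy_min p N f J -> polyN N q ->
  normc q`_0 `^ p * energy p f J <= energy p f q ?= iff (q == q`_0 *: J).
Proof.
move=> p1 pf f0 mJ sq; have [[sJ J0] Jmin] := mJ.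
have pn0 : p != 0 by rewrite gt_eqF // (lt_trans ltr01).
have [c0|c0] := eqVneq q`_0 0.
  rewrite c0 normc0 powR0 // mul0r scale0r; split; first exact: energy_ge0.
  have [->|qn0] := eqVneq q 0; last by rewrite lt_eqF // energy_gt0.
  by rewrite energy0 // !eqxx.
pose g := (q`_0)^-1 *: q.
have qg : q = q`_0 *: g by rewrite scalerA divff // scale1r.
have sg : polyN N g by rewrite /polyN /= (leq_trans (size_scale_leq _ _)).
have g0 : g`_0 = 1 by rewrite coefZ mulVf.
have cp : 0 < normc q`_0 `^ p by rewrite powR_gt0 // normc_gt0.
rewrite [in X in _ <= X ?= iff _]qg energyZ; split.
  by rewrite (ler_pM2l cp) Jmin.
apply/eqP/eqP => [/(mulfI (lt0r_neq0 cp)) eJ|qJ].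
  rewrite [LHS]qg; congr (_ *: _).
  by apply: (energy_min_unique p N f); rewrite // eJ.
by rewrite -!energyZ -qg -qJ.
Qed.

End Energy.

(** * Identifying [J_N], its quotient by [f], and the approximant *)

(** [xget] picks an unspecified minimiser; uniqueness of the energy minimiser determines it. *)
Lemma JN_energy_min {R : realType} (p : R) N f J :
  1 < p -> ellpA p f -> f 0%N = 1 -> energy_min p N f J ->
  JN p N f = ps_mulp f J.
Proof.
move=> p1 pf f0 mJ; have [[sJ J0] Jmin] := mJ.
have p0 : 0 < p^-1 by rewrite invr_gt0 (lt_trans ltr01).
have p1' := ltW p1.
apply: xget_unique.
  split; first by rewrite /= ps_mulp0 // J0; split=> //; exists J.
  move=> _ [[q sq <-]]; rewrite ps_mulp0 // => q0.
  by rewrite !ellp_norm_ps_mulp // lee_fin ler_powR2r ?energy_ge0 // Jmin.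
move=> _ [[[q sq <-]]]; rewrite ps_mulp0 // => q0 qmin; congr ps_mulp.
apply: (energy_min_unique p N f) => //.
rewrite -(ler_powR2r _ _ _ p0) ?energy_ge0 // -lee_fin -!ellp_norm_ps_mulp //.
by apply: qmin; rewrite /= ps_mulp0 //; split=> //; exists J.
Qed.

Lemma ps_quot_mulp {R : realType} N (f : nat -> R[i]) q :
  f 0%N = 1 -> polyN N q -> ps_quot N (ps_mulp f q) f = q.
Proof.
move=> f0 sq; apply: xget_unique => // r [_ /ps_mulp_inj ->] //.
Qed.

Lemma opa_unique {R : realType} (p : R) N f q :
  polyN N q ->
  (forall r, polyN N r -> (opa_error p f q <= opa_error p f r)%E) ->
  (forall r, polyN N r -> (opa_error p f r <= opa_error p f q)%E -> r = q) ->
  opa p N f = q.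
Proof.
move=> sq qmin quniq; apply: xget_unique => [|r [sr re]].
  split=> //; apply/eqP; rewrite eq_le; apply/andP; split.
    by apply: le_ereal_inf_tmp => _ [r sr <-]; exact: qmin.
  by apply: ereal_inf_lbound; exists q.
by apply: quniq => //; rewrite re; apply: ereal_inf_lbound; exists q.
Qed.

Theorem theorem4p10 (R : realType) (p p' : R) (N : nat) (f : nat -> R[i])
    (hp : 1 < p) (hp' : p^-1 + p'^-1 = 1) (hN : (1 <= N)%N)
    (hf : ellpA p f) (hf0 : f 0%N = 1) :
  opa p N f =
    ((1 + (fine (ellp_norm p (JN p N f)) `^ p - 1) `^ (p' - 1))%:C)^-1
      *: ps_quot N (JN p N f) f.
Proof.
have hp1 := ltW hp; have p0 : 0 < p by exact: lt_trans hp.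
have [J mJ] := energy_min_exists p N f hp1 hf.
have [[sJ J0] _] := mJ.
rewrite (JN_energy_min p N f J) // ps_quot_mulp // ellp_norm_ps_mulp //=.
rewrite -powRrM mulVf ?gt_eqF // powRr1 ?energy_ge0 //.
rewrite -fmorphV /=.
set t := energy p f J - 1; set c := (1 + _)^-1.
(* The constant coefficient of [f J] alone contributes 1 to the energy. *)
have t0 : 0 <= t.
  rewrite subr_ge0 (le_trans _ (energy_ge_coef0 p f J hp1 hf hf0)) //.
  by rewrite J0 normc1 powR1.
have c0 : 0 <= c by rewrite invr_ge0 addr_ge0 ?powR_ge0.
have c1 : 0 <= 1 - c.
  by rewrite subr_ge0 invf_le1 ?lerDl ?ltr_pwDl ?powR_ge0.
(* These are errors to the power [p]. The bound adds [hom], comparing [q] with [q_0 J], to [scal],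
   comparing [q_0] with [c]. Equality in the sum forces it in both, hence [q_0 = c] and
   [q = c J]. *)
have err q : polyN N q ->
    normc (1 - c%:C) `^ p + (energy p f (c%:C *: J) - normc c%:C `^ p) <=
    normc (1 - q`_0) `^ p + (energy p f q - normc q`_0 `^ p)
    ?= iff (q == c%:C *: J).
  move=> sq.
  have [/= scal scaleq] := powR_normc_affine_min p p' t q`_0 hp hp' t0.
  have [hom homeq] := energy_min_homogeneous p N f J q hp hf hf0 mJ sq.
  have lhsE : normc (1 - c%:C) `^ p +
      (energy p f (c%:C *: J) - normc c%:C `^ p) = (1 - c) `^ p + c `^ p * t.
    rewrite energyZ -(rmorph1 (real_complex R)) -rmorphB !normc_real /=.
    by rewrite !ger0_norm // /t; ring.
  have EJ : energy p f J = t + 1 by rewrite subrK.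
  rewrite EJ mulrDr mulr1 in hom homeq.
  rewrite lhsE; split; first by rewrite -/c in scal; lra.
  apply/eqP/eqP => [eqE|->]; last first.
    by rewrite coefZ J0 mulr1.
  rewrite -/c in scal scaleq.
  have /eqP : (1 - c) `^ p + c `^ p * t =
      normc (1 - q`_0) `^ p + normc q`_0 `^ p * t by lra.
  rewrite scaleq => /eqP q0c.
  have /eqP : normc q`_0 `^ p * t + normc q`_0 `^ p = energy p f q by lra.
  by rewrite homeq q0c => /eqP.
have base_ge0 (q : {poly R[i]}) :
    0 <= normc (1 - q`_0) `^ p + (energy p f q - normc q`_0 `^ p).
  by rewrite addr_ge0 ?powR_ge0 // subr_ge0 energy_ge_coef0.
have scJ : polyN N (c%:C *: J).
  by rewrite /polyN /= (leq_trans (size_scale_leq _ _)).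
have p0' : 0 < p^-1 by rewrite invr_gt0.
have cJ0 : (c%:C *: J)`_0 = c%:C by rewrite coefZ J0 mulr1.
have errE q := opa_errorE p f q hp1 hf hf0.
(* Taking [p]-th roots of nonnegative numbers preserves order, so [err] gives both optimality and
   uniqueness. *)
apply: opa_unique => [//|q sq|q sq]; rewrite !errE lee_fin.
  rewrite (ler_powR2r _ _ _ p0' (base_ge0 _) (base_ge0 _)).
  by rewrite cJ0; have [] := err q sq.
rewrite (ler_powR2r _ _ _ p0' (base_ge0 _) (base_ge0 _)).
have [le eqE] := err q sq.
by rewrite cJ0 => ge; apply/eqP; rewrite -eqE eq_le le.
Qed.
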